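(* Let $f:X\to Y$ be a map of multipointed $d$-spaces between two cellular multipointed $d$-spaces $X$ and $Y$. The following are equivalent: (1) $f$ is a globular subdivision, i.e. the underlying continuous map $f:|X|\to|Y|$ is a homeomorphism; (2) the map of directed spaces $\vec{\mathrm{Sp}}(f):\vec{\mathrm{Sp}}(X)\to\vec{\mathrm{Sp}}(Y)$ is an isomorphism.
   Context: $\mathcal{M}(\ell,\ell')$: non-decreasing surjective continuous maps $[0,\ell]\to[0,\ell']$; $\mathcal{I}(1)$: non-decreasing continuous maps $[0,1]\to[0,1]$; $\mu_\ell(t)=t/\ell$. A multipointed $d$-space is $(|X|,X^0,\mathbb{P}^{\mathrm{top}}X)$: a space, a set of states $X^0\subset|X|$, a set of continuous maps $[0,1]\to|X|$ (execution paths) with endpoints in $X^0$, closed under precomposition by $\mathcal{M}(1,1)$ and normalized composition $\gamma_1*_N\gamma_2$ ($\gamma_1(2t)$ on $[0,1/2]$, $\gamma_2(2t-1)$ on $[1/2,1]$); maps are continuous maps preserving states and execution paths. A directed space is $(|Y|,d(Y))$ with $d(Y)$ a set of paths $[0,1]\to|Y|$ containing constants, closed under normalized composition and precomposition by $\mathcal{I}(1)$; morphisms preserve directed paths. $\vec{\mathrm{Sp}}(X)$ is the directed space on $|X|$ whose directed paths are the constant paths and the Moore concatenations $(\gamma_1\phi_1\mu_{\ell_1})*\dots*(\gamma_n\phi_n\mu_{\ell_n})$, $\ell_i>0$, $\sum\ell_i=1$, $\gamma_i$ execution paths, $\phi_i\in\mathcal{I}(1)$; $\vec{\mathrm{Sp}}(f)$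 has the same underlying map as $f$. $\mathrm{Glob}^{\mathrm{top}}(Z)$: quotient of $\{0,1\}\sqcup Z\times[0,1]$ by $(z,0)\sim0$, $(z,1)\sim1$; states $\{0,1\}$; execution paths $\delta_z\phi$, $\delta_z(t)=(z,t)$, $\phi\in\mathcal{M}(1,1)$. A cellular multipointed $d$-space is a colimit $\varinjlim_{\nu<\lambda}X_\nu$ of a colimit-preserving functor on an ordinal $\lambda$ with $X_0=(X^0,X^0,\varnothing)$ for a set $X^0$ and each $X_{\nu+1}$ a pushout of $\mathrm{Glob}^{\mathrm{top}}(\mathbf{S}^{n_\nu-1})\to\mathrm{Glob}^{\mathrm{top}}(\mathbf{D}^{n_\nu})$ (induced by the inclusion of the boundary sphere into the closed disk, $\mathbf{S}^{-1}=\varnothing$, $n_\nu\ge0$) along a map into $X_\nu$. A globular subdivision is a map of multipointed $d$-spaces between cellular multipointed $d$-spaces whose underlying continuous map is a homeomorphism. *)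

(* Defs.v *)
From mathcomp Require Import all_boot all_order all_algebra.
From mathcomp Require Import all_classical all_reals all_analysis.
From mathcomp Require Import Rstruct Rstruct_topology.
Set Implicit Arguments.
Unset Strict Implicit.
Unset Printing Implicit Defensive.
Import Order.TTheory GRing.Theory Num.Theory.
Local Open Scope classical_set_scope.
Local Open Scope ring_scope.

Definition RR : realType := Rdefinitions.R.

Definition I01 : set RR := [set t | 0 <= t <= 1].

(* Retraction of RR onto [0,1].  A continuous map [0,1] -> T is represented
   by a function g : RR -> T that is continuous on [0,1] and satisfies
   g t = g (clamp t) (so that it is determined by its values on [0,1]). *)
Definition clamp (t : RR) : RR := Num.max 0 (Num.min t 1).

Definition is_path {T : topologicalType} (g : RR -> T) : Prop :=
  {within I01, continuous g} /\ (forall t, g t = g (clamp t)).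

Definition open_in_I01 (A : set RR) : Prop :=
  exists W : set RR, open W /\ W `&` I01 = A `&` I01.

Definition delta_generated (T : topologicalType) : Prop :=
  forall U : set T,
    (forall g : RR -> T, {within I01, continuous g} -> open_in_I01 (g @^-1` U)) ->
    open U.

Definition is_M11 (phi : RR -> RR) : Prop :=
  [/\ {within I01, continuous phi},
      (forall s t, I01 s -> I01 t -> s <= t -> phi s <= phi t)
    & phi @` I01 = I01].

Definition is_I1 (phi : RR -> RR) : Prop :=
  [/\ {within I01, continuous phi},
      (forall s t, I01 s -> I01 t -> s <= t -> phi s <= phi t)
    & phi @` I01 `<=` I01].

Definition ncomp {T : Type} (g1 g2 : RR -> T) : RR -> T :=
  fun t => let s := clamp t in
    if s <= 1 / 2 then g1 (2 * s) else g2 (2 * s - 1).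

Definition reparam {T : Type} (g : RR -> T) (phi : RR -> RR) : RR -> T :=
  fun t => g (phi (clamp t)).

Record mdspace := MDSpace {
  md_carrier :> topologicalType;
  md_states : set md_carrier;
  md_exec : set (RR -> md_carrier);
  md_dgen : delta_generated md_carrier;
  md_exec_path : forall g, md_exec g -> is_path g;
  md_exec_ends : forall g, md_exec g -> md_states (g 0) /\ md_states (g 1);
  md_exec_reparam : forall g phi, md_exec g -> is_M11 phi ->
                      md_exec (reparam g phi);
  md_exec_comp : forall g1 g2, md_exec g1 -> md_exec g2 -> g1 1 = g2 0 ->
                      md_exec (ncomp g1 g2)
}.
Arguments md_states : clear implicits.
Arguments md_exec : clear implicits.

Definition mdmap {X Y : mdspace} (f : X -> Y) : Prop :=
  [/\ continuous f,
      (forall x : X, md_states X x -> md_states Y (f x))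
    & (forall g : RR -> X, md_exec X g -> md_exec Y (f \o g))].

Definition is_colimit {O : Type} (le : O -> O -> Prop) (P : set O)
    (D : O -> mdspace) (m : forall i j, D i -> D j)
    (C : mdspace) (c : forall i, D i -> C) : Prop :=
  [/\ (forall i, P i -> mdmap (c i)),
      (forall i j, P i -> P j -> le i j -> c j \o m i j = c i)
    & (forall (W : mdspace) (d : forall i, D i -> W),
         (forall i, P i -> mdmap (d i)) ->
         (forall i j, P i -> P j -> le i j -> d j \o m i j = d i) ->
         exists h : C -> W,
           [/\ mdmap h, (forall i, P i -> h \o c i = d i)
             & (forall h' : C -> W, mdmap h' ->
                  (forall i, P i -> h' \o c i = d i) -> h' = h)])].

Arguments is_colimit {O} le P D m C c.

Definition is_pushout {A B1 B2 P : mdspace} (f1 : A -> B1) (f2 : A -> B2)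
    (i1 : B1 -> P) (i2 : B2 -> P) : Prop :=
  [/\ mdmap i1, mdmap i2, i1 \o f1 = i2 \o f2
    & (forall (W : mdspace) (u : B1 -> W) (v : B2 -> W),
         mdmap u -> mdmap v -> u \o f1 = v \o f2 ->
         exists h : P -> W,
           [/\ mdmap h, h \o i1 = u, h \o i2 = v
             & (forall h' : P -> W, mdmap h' -> h' \o i1 = u -> h' \o i2 = v ->
                  h' = h)])].

Definition sphere (n : nat) : set 'rV[RR]_n :=
  [set x | \sum_(i < n) (x ord0 i) ^+ 2 = 1].
Definition disk (n : nat) : set 'rV[RR]_n :=
  [set x | \sum_(i < n) (x ord0 i) ^+ 2 <= 1].
Arguments sphere : clear implicits.
Arguments disk : clear implicits.

(* (G, q, e) presents G as Glob^top(Z), for Z a subspace of R^n: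
   the underlying space of G is the quotient of {0,1} + Z x [0,1]
   by (z,0) ~ 0, (z,1) ~ 1, via the quotient map given by q on {0,1}
   (false = 0, true = 1) and (z,t) |-> e z t on Z x [0,1];
   states are {0,1}; execution paths are the delta_z phi, phi in M(1,1). *)
Definition is_glob (n : nat) (Z : set 'rV[RR]_n) (G : mdspace)
    (q : bool -> G) (e : 'rV[RR]_n -> RR -> G) : Prop :=
  [/\ {within Z `*` I01, continuous (fun p => e p.1 p.2)},
      (forall z, Z z -> e z 0 = q false /\ e z 1 = q true),
      q false <> q true,
      (forall z z' t t', Z z -> Z z' -> 0 < t < 1 -> 0 < t' < 1 ->
         e z t = e z' t' -> z = z' /\ t = t')
    & [/\ (forall z t b, Z z -> 0 < t < 1 -> e z t <> q b),
      (forall y : G, (exists b, y = q b) \/ (exists z t, [/\ Z z, I01 t & y = e z t])),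
      (forall U : set G, open U <->
         exists W : set ('rV[RR]_n * RR),
           open W /\ W `&` (Z `*` I01) = (fun p => e p.1 p.2) @^-1` U `&` (Z `*` I01)),
      md_states G = range q
    & md_exec G = [set g | exists z phi, [/\ Z z, is_M11 phi & g = (fun t => e z (phi (clamp t)))]]]].

Definition discrete_md (X : mdspace) : Prop :=
  [/\ (forall U : set X, open U), md_states X = setT & md_exec X = set0].

Definition strict_wellorder {O : Type} (lt : O -> O -> Prop) : Prop :=
  [/\ (forall i, ~ lt i i),
      (forall i j k, lt i j -> lt j k -> lt i k),
      (forall i j, [\/ lt i j, i = j | lt j i])
    & well_founded lt].

Definition is_succ {O : Type} (lt : O -> O -> Prop) (i j : O) : Prop :=
  lt i j /\ (forall k, ~ (lt i k /\ lt k j)).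

Definition is_limit_index {O : Type} (lt : O -> O -> Prop) (i : O) : Prop :=
  (exists j, lt j i) /\ (forall j, ~ is_succ lt j i).

(* Cellular multipointed d-spaces: X = colim_{nu < lambda} X_nu for a
   colimit-preserving functor nu |-> X_nu on an ordinal lambda (presented as
   a strictly well-ordered type (O, lt)), X_0 discrete of the form
   (X^0, X^0, empty), and X_{nu+1} a pushout of
   Glob^top(S^{n-1}) -> Glob^top(D^n) along a map Glob^top(S^{n-1}) -> X_nu. *)
Definition cellular (X : mdspace) : Prop :=
  exists (O : Type) (lt : O -> O -> Prop) (D : O -> mdspace)
         (m : forall i j, D i -> D j) (c : forall i, D i -> X),
    let le := fun i j => lt i j \/ i = j in
    [/\ strict_wellorder lt,
        (forall i j, le i j -> mdmap (m i j)),
        (forall i, m i i = id),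
        (forall i j k, le i j -> le j k -> m i k = m j k \o m i j)
      & [/\ (forall i, (forall j, ~ lt j i) -> discrete_md (D i)),
        (forall i j, is_succ lt i j ->
           exists (n : nat) (GS : mdspace) (qS : bool -> GS) (eS : 'rV[RR]_n -> RR -> GS)
                  (GD : mdspace) (qD : bool -> GD) (eD : 'rV[RR]_n -> RR -> GD)
                  (iota : GS -> GD) (a : GS -> D i) (b : GD -> D j),
             [/\ is_glob (sphere n) qS eS, is_glob (disk n) qD eD,
                 (forall bb, iota (qS bb) = qD bb),
                 (forall z t, sphere n z -> I01 t -> iota (eS z t) = eD z t)
               & mdmap a /\ is_pushout a iota (m i j) b]),
        (forall i, is_limit_index lt i ->
           is_colimit le (fun j => lt j i) D m (D i) (fun j => m j i))
      & is_colimit le setT D m X c]].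

(* The directed paths of Sp(X): constant paths and Moore concatenations
   (g_0 phi_0 mu_{l_0}) * ... * (g_{n-1} phi_{n-1} mu_{l_{n-1}}). *)
Fixpoint moore_from {T : Type} (l : nat -> RR) (g : nat -> RR -> T)
    (phi : nat -> RR -> RR) (k i : nat) (t : RR) : T :=
  match k with
  | 0 => g i (phi i (clamp (t / l i)))
  | k'.+1 => if t <= l i then g i (phi i (clamp (t / l i)))
             else moore_from l g phi k' i.+1 (t - l i)
  end.

Definition moore {T : Type} (n : nat) (l : nat -> RR) (g : nat -> RR -> T)
    (phi : nat -> RR -> RR) : RR -> T :=
  fun t => moore_from l g phi n.-1 0 (clamp t).

Definition Sp_paths (X : mdspace) : set (RR -> X) :=
  [set gam | (exists x : X, gam = (fun _ => x)) \/
    exists (n : nat) (l : nat -> RR) (g : nat -> RR -> X) (phi : nat -> RR -> RR),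
      [/\ (0 < n)%N,
          (forall i, (i < n)%N -> [/\ 0 < l i, md_exec X (g i) & is_I1 (phi i)]),
          \sum_(i < n) l i = 1,
          (forall i, (i.+1 < n)%N -> g i (phi i 1) = g i.+1 (phi i.+1 0))
        & gam = moore n l g phi]].

Arguments Sp_paths : clear implicits.

Definition dmap {S T : topologicalType} (dS : set (RR -> S)) (dT : set (RR -> T))
    (f : S -> T) : Prop :=
  continuous f /\ (forall g, dS g -> dT (f \o g)).

Definition dspace_iso {S T : topologicalType} (dS : set (RR -> S)) (dT : set (RR -> T))
    (f : S -> T) : Prop :=
  dmap dS dT f /\ exists h : T -> S, [/\ dmap dT dS h, cancel f h & cancel h f].

Definition Sp_iso {X Y : mdspace} (f : X -> Y) : Prop :=
  dspace_iso (Sp_paths X) (Sp_paths Y) f.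

Definition homeomorphism {S T : topologicalType} (f : S -> T) : Prop :=
  continuous f /\ exists h : T -> S, [/\ continuous h, cancel f h & cancel h f].

(* Main.v *)
(** A cellular multipointed d-space is, as a
    set, the disjoint union of its states and of the open arcs traced by the
    paths [delta_z] with [z] in the interior of the disk of some globular cell;
    its execution paths are the finite concatenations of reparametrised closed
    arcs.  These facts involve no topology: they follow from the universal
    properties tested against indiscrete spaces (for the underlying sets) and
    against the same space with fewer states and execution paths.

    Let [f] be a bijective map with inverse [h] and [g] an arc of [Y].  The point
    [h (g (1/2))] is not a state, hence lies on an arc [p] of [X].  The execution
    path [f \o p] is a concatenation of arcs of [Y] and meets the interior of [g],
    so it traverses [g] entirely: [f (p u) = g (chi u)] on some [[a,b]], with
    [chi] non-decreasing onto [[0,1]].  As [f \o p] is injective on the open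
    interval, [chi] is invertible, and [h \o g = p \o chi^-1] is directed. *)

From HB Require Import structures.
Require Import Defs.
From mathcomp Require Import all_boot all_order all_algebra.
From mathcomp Require Import all_classical all_reals all_analysis.
From mathcomp Require Import Rstruct Rstruct_topology lra.
Set Implicit Arguments.
Unset Strict Implicit.
Unset Printing Implicit Defensive.
Import Order.TTheory GRing.Theory Num.Theory.
Import numFieldNormedType.Exports.
Local Open Scope classical_set_scope.
Local Open Scope ring_scope.

(** * Monotone reparametrisations and Moore concatenations *)

Lemma clamp_id (t : RR) : 0 <= t -> t <= 1 -> clamp t = t.
Proof. by move=> t0 t1; rewrite /clamp min_l// max_r. Qed.

Lemma clamp_ge0 (t : RR) : 0 <= clamp t.
Proof. by rewrite /clamp le_max lexx. Qed.

Lemma clamp_le1 (t : RR) : clamp t <= 1.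
Proof. by rewrite /clamp ge_max ler01 ge_min lexx orbT. Qed.

Lemma clamp_clamp (t : RR) : clamp (clamp t) = clamp t.
Proof. by rewrite clamp_id ?clamp_ge0 ?clamp_le1. Qed.

Lemma I01_clamp (t : RR) : I01 (clamp t).
Proof. by rewrite /I01/= clamp_ge0 clamp_le1. Qed.

Lemma I01_itv : I01 = `[0 : RR, 1 : RR]%classic.
Proof. by apply/seteqP; split=> t; rewrite /I01/= in_itv. Qed.

(* For a monotone function, continuity on [a,b] is the intermediate value
   property; the latter is stable under composition by elementary means. *)
Definition mono_ivp (a b : RR) (psi : RR -> RR) : Prop :=
  (forall s t, a <= s -> s <= t -> t <= b -> psi s <= psi t) /\
  (forall y, psi a <= y -> y <= psi b -> exists x, [/\ a <= x, x <= b & psi x = y]).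

(** A value [y] of the composite is first attained by [chi] at some [z] in [[c,d]]. If [z] falls
    outside [[psi a, psi b]], monotonicity forces [chi] to take the value [y] at an endpoint as
    well; otherwise [z] is lifted through [psi]. *)
Lemma mono_ivp_comp (a b c d : RR) (chi psi : RR -> RR) : a <= b ->
  mono_ivp a b psi -> mono_ivp c d chi -> c <= psi a -> psi b <= d ->
  mono_ivp a b (chi \o psi).
Proof.
move=> ab [pm pv] [cm cv] ca bd; split=> [s t as_ st tb/=|y ya yb].
  apply: cm; [|exact: pm|].
  - by apply: le_trans ca _; apply: pm => //; exact: le_trans tb.
  - by apply: le_trans bd; apply: pm => //; exact: le_trans st.
have pab : psi a <= psi b by apply: pm.
have [z [cz zd zy]] : exists z, [/\ c <= z, z <= d & chi z = y].
  by apply: cv; [apply: le_trans ya; apply: cm => //; lra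
                |apply: le_trans yb _; apply: cm => //; lra].
have [za|az] := ltP z (psi a).
  exists a; split=> //; apply/eqP; rewrite eq_le ya /= -zy.
  by apply: cm => //; lra.
have [bz|zb] := ltP (psi b) z.
  exists b; split=> //; apply/eqP; rewrite eq_le yb andbT -zy /=.
  by apply: cm => //; lra.
have [x [ax xb xz]] := pv z az zb.
by exists x; split=> //=; rewrite xz.
Qed.

Lemma mono_ivp_affine (k r a b : RR) : 0 < k -> mono_ivp a b (fun t => k * t + r).
Proof.
move=> k0; split=> [s t _ st _|y ya yb]; first by rewrite lerD2r ler_pM2l.
exists ((y - r) / k); split; last by rewrite mulrC divfK ?subrK ?gt_eqF.
- by rewrite ler_pdivlMr// mulrC; lra.
- by rewrite ler_pdivrMr// [b * k]mulrC; lra.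
Qed.

Lemma mono_ivp_sub (a b c d : RR) (psi : RR -> RR) : c <= a -> a <= b -> b <= d ->
  mono_ivp c d psi -> mono_ivp a b psi.
Proof.
(* Restriction is precomposition with the identity, written as an affine map. *)
move=> ca ab bd h; have := @mono_ivp_comp a b c d psi (fun t => 1 * t + 0) ab.
have -> : psi \o (fun t => 1 * t + 0) = psi.
  by apply/funext => t /=; rewrite mul1r addr0.
by apply => //; [exact: mono_ivp_affine|rewrite mul1r addr0|rewrite mul1r addr0].
Qed.

Lemma mono_ivp_eq (a b : RR) (psi chi : RR -> RR) : a <= b ->
  (forall t, a <= t -> t <= b -> psi t = chi t) ->
  mono_ivp a b psi -> mono_ivp a b chi.
Proof.
move=> ab e [pm pv]; split=> [s t as_ st tb|y].
  by rewrite -!e ?pm //; lra.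
by rewrite -!e // => ya yb; have [x [? ? <-]] := pv y ya yb; exists x; rewrite e.
Qed.

Lemma I1_mono_ivp (phi : RR -> RR) : is_I1 phi -> mono_ivp 0 1 phi.
Proof.
move=> [pc pm _]; split=> [s t s0 st t1|y y0 y1].
  by apply: pm => //; rewrite /I01/= ?s0 ?t1 ?andbT /=; lra.
have p01 : phi 0 <= phi 1 by lra.
have [||c c01 cy] := @IVT RR phi 0 1 y ler01; first by rewrite -I01_itv.
  by rewrite min_l// max_r// y0 y1.
by exists c; move: c01; rewrite in_itv/= => /andP[].
Qed.

(** A monotone function without jumps is continuous: the level [phi x - e] either lies below
    [phi 0], or is attained at some [u < x] and bounds [phi] from below to the right of [u]. The
    upper bound is symmetric. *)
Lemma mono_ivp_continuous (phi : RR -> RR) : mono_ivp 0 1 phi ->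
  {within I01, continuous phi}.
Proof.
move=> [pm pv]; apply/subspace_continuousP => x /andP[x0 x1].
have p0x := pm 0 x (lexx _) x0 x1.
have px1 := pm x 1 x0 x1 (lexx _).
apply/cvgrPdist_le => e e0.
have L : \forall t \near within I01 (nbhs x), phi x - e <= phi t.
  have [h|h] := leP (phi 0) (phi x - e); last first.
    near=> t; have /andP[t0 t1] : I01 t by near: t; exact: withinT.
    by apply: le_trans (ltW h) _; apply: pm.
  have [|u [u0 u1 ux]] := pv _ h; first lra.
  have lux : u < x by rewrite ltNge; apply/negP => /(fun h => pm x u x0 h u1); lra.
  near=> t; have /andP[t0 t1] : I01 t by near: t; exact: withinT.
  rewrite -ux; apply: pm => //; apply: ltW; near: t.
  by apply: cvg_within; exact: lt_nbhsr.
have U : \forall t \near within I01 (nbhs x), phi t <= phi x + e.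
  have [h|h] := leP (phi x + e) (phi 1); last first.
    near=> t; have /andP[t0 t1] : I01 t by near: t; exact: withinT.
    by apply: le_trans (ltW h); apply: pm.
  have [|u [u0 u1 ux]] := pv _ _ h; first lra.
  have lux : x < u by rewrite ltNge; apply/negP => /(fun h => pm u x u0 h x1); lra.
  near=> t; have /andP[t0 t1] : I01 t by near: t; exact: withinT.
  rewrite -ux; apply: pm => //; apply: ltW; near: t.
  by apply: cvg_within; exact: lt_nbhsl.
near=> t.
have tL : phi x - e <= phi t by near: t.
have tU : phi t <= phi x + e by near: t.
by rewrite ler_distlC tL tU.
Unshelve. all: by end_near.
Qed.

(** Moore concatenations over an arbitrary interval, without lengths or normalisation. Consecutive
    pieces match automatically, since both describe the same function [gam] at the breakpoint
    [c]. *)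
Inductive dpath (T : Type) (E : set (RR -> T)) : RR -> RR -> (RR -> T) -> Prop :=
| dpath_one a b gam p psi : a < b -> E p -> mono_ivp a b psi ->
    0 <= psi a -> psi b <= 1 ->
    (forall t, a <= t -> t <= b -> gam t = p (psi t)) -> dpath E a b gam
| dpath_cons a c b gam p psi : a < c -> E p -> mono_ivp a c psi ->
    0 <= psi a -> psi c <= 1 ->
    (forall t, a <= t -> t <= c -> gam t = p (psi t)) ->
    dpath E c b gam -> dpath E a b gam.

Section DirectedPaths.
Variables (T : Type) (E : set (RR -> T)).

Lemma dpath_lt a b gam : dpath E a b gam -> a < b.
Proof. by elim=> // {}a c {}b {}gam p psi ac *; exact: lt_trans ac _. Qed.

Lemma dpath_cat a c b gam : dpath E a c gam -> dpath E c b gam -> dpath E a b gam.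
Proof.
move=> h; elim: h => {a c gam} [a c gam p psi ac Ep m p0 p1 e h|a c d gam p psi ac Ep m p0 p1 e _ IH h].
  exact: (dpath_cons ac Ep m p0 p1 e h).
exact: (dpath_cons ac Ep m p0 p1 e (IH h)).
Qed.

Lemma dpath_eq a b gam gam' : (forall t, a <= t -> t <= b -> gam t = gam' t) ->
  dpath E a b gam -> dpath E a b gam'.
Proof.
move=> e h; elim: h gam' e => {a b gam}
    [a b gam p psi ab Ep m p0 p1 g|a c b gam p psi ac Ep m p0 p1 g h IH] gam' e.
  by apply: (dpath_one ab Ep m p0 p1) => t ta tb; rewrite -e// g.
have cb := dpath_lt h.
apply: (dpath_cons ac Ep m p0 p1); last by apply: IH => t ct tb; apply: e => //; lra.
by move=> t ta tc; rewrite -e ?g//; lra.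
Qed.

Lemma dpath_comp c d a b gam psi : dpath E c d gam -> a < b -> mono_ivp a b psi ->
  c <= psi a -> psi b <= d -> dpath E a b (gam \o psi).
Proof.
move=> h; elim: h a b psi => {c d gam}
    [c d gam p chi cd Ep m p0 p1 g|c e d gam p chi ce Ep m p0 p1 g h IH] a b psi ab mp ca bd.
  have pab : psi a <= psi b by apply: mp.1 => //; exact: ltW.
  apply: (dpath_one (p := p) (psi := chi \o psi)) => //=.
  - by apply: mono_ivp_comp m ca bd => //; exact: ltW.
  - by apply: le_trans p0 _; apply: m.1 => //; lra.
  - by apply: le_trans p1; apply: m.1 => //; lra.
  - by move=> t ta tb; apply: g; [apply: le_trans ca _|apply: le_trans bd];
      apply: mp.1.
have one a' b' : a' < b' -> mono_ivp a' b' psi -> c <= psi a' -> psi b' <= e ->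
    [/\ mono_ivp a' b' (chi \o psi), 0 <= chi (psi a'), chi (psi b') <= 1
      & forall t, a' <= t -> t <= b' -> gam (psi t) = p (chi (psi t))].
  move=> ab' m' ca' be'; have pab : psi a' <= psi b' by apply: m'.1 => //; exact: ltW.
  split.
  - by apply: mono_ivp_comp m ca' be' => //; exact: ltW.
  - by apply: le_trans p0 _; apply: m.1 => //; lra.
  - by apply: le_trans p1; apply: m.1 => //; lra.
  - by move=> t ta tb; apply: g; [apply: le_trans ca' _|apply: le_trans be'];
      apply: m'.1.
have [be|eb] := leP (psi b) e.
  have [m' h0 h1 g'] := one a b ab mp ca be.
  exact: (dpath_one ab Ep m' h0 h1).
have [ea|ae] := leP e (psi a); first by apply: IH.
(* The breakpoint [e] lies strictly between [psi a] and [psi b], so it pulls back to a breakpoint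
   [x] of the composite. *)
have [x [ax xb xe]] := mp.2 e (ltW ae) (ltW eb).
have {}ax : a < x by rewrite lt_neqAle ax andbT; apply/eqP => ax'; move: ae; rewrite ax' xe ltxx.
have {}xb : x < b by rewrite lt_neqAle xb andbT; apply/eqP => xb'; move: eb; rewrite -xb' xe ltxx.
have [||m' h0 h1 g'] := one a x ax _ ca _.
- by apply: mono_ivp_sub mp => //; lra.
- by rewrite xe.
apply: (dpath_cons ax Ep m' h0 h1) => //; apply: IH => //.
- by apply: mono_ivp_sub mp => //; lra.
- by rewrite xe.
Qed.

End DirectedPaths.

(** * Comparison of subdivided paths with Moore concatenations *)

Lemma moore_from_shift (T : Type) (l l' : nat -> RR) (g g' : nat -> RR -> T)
    (phi phi' : nat -> RR -> RR) k i t :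
  (forall j, l' j.+1 = l j) -> (forall j, g' j.+1 = g j) ->
  (forall j, phi' j.+1 = phi j) ->
  moore_from l' g' phi' k i.+1 t = moore_from l g phi k i t.
Proof.
move=> el eg ep; elim: k i t => [|k IH] i t /=; first by rewrite el eg ep.
by rewrite el eg ep IH.
Qed.

Lemma moore_from0 (T : Type) (l : nat -> RR) (g : nat -> RR -> T)
    (phi : nat -> RR -> RR) k i : 0 < l i ->
  moore_from l g phi k i 0 = g i (phi i 0).
Proof.
by move=> li; case: k => [|k] /=; rewrite ?(ltW li) mul0r clamp_id.
Qed.

Lemma moore_from_comp (S T : Type) (f : S -> T) (l : nat -> RR)
    (g : nat -> RR -> S) (phi : nat -> RR -> RR) k i t :
  f (moore_from l g phi k i t) = moore_from l (fun j => f \o g j) phi k i t.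
Proof. by elim: k i t => //= k IH i t; case: ifP. Qed.

Lemma dpath_moore_from (T : Type) (E : set (RR -> T)) (l : nat -> RR)
    (g : nat -> RR -> T) (phi : nat -> RR -> RR) k i :
  (forall j, (i <= j <= i + k)%N -> [/\ 0 < l j, E (g j) & is_I1 (phi j)]) ->
  (forall j, (i <= j < i + k)%N -> g j (phi j 1) = g j.+1 (phi j.+1 0)) ->
  dpath E 0 (\sum_(j < k.+1) l (i + j)%N) (moore_from l g phi k i).
Proof.
have piece j : 0 < l j -> is_I1 (phi j) ->
    [/\ mono_ivp 0 (l j) (fun t => phi j (clamp (t / l j))),
        0 <= phi j (clamp (0 / l j)) & phi j (clamp (l j / l j)) <= 1].
  move=> lj Ip; have [_ _ sub] := Ip; split.
  - apply: (@mono_ivp_eq _ _ (phi j \o fun t => (l j)^-1 * t + 0)); first exact: ltW.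
      move=> t t0 tl /=; rewrite addr0 mulrC clamp_id//.
        by rewrite divr_ge0// ltW.
      by rewrite ler_pdivrMr// mul1r.
    apply: mono_ivp_comp (I1_mono_ivp Ip) _ _; first exact: ltW.
    + by apply: mono_ivp_affine; rewrite invr_gt0.
    + by rewrite mulr0 addr0.
    + by rewrite mulVf ?gt_eqF// addr0.
  - by have /andP[] := sub _ (imageP (phi j) (I01_clamp (0 / l j))).
  - by have /andP[] := sub _ (imageP (phi j) (I01_clamp (l j / l j))).
elim: k i => [|k IH] i H C.
  have [li Eg Ip] := H i ltac:(by rewrite addn0 leqnn).
  have [m p0 p1] := piece i li Ip.
  by rewrite big_ord1 addn0; apply: (dpath_one li Eg m p0 p1).
have [li Eg Ip] := H i ltac:(by rewrite leqnn leq_addr).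
have [lS _ _] := H i.+1 ltac:(by rewrite leqnSn addnS ltnS leq_addr).
have [m p0 p1] := piece i li Ip.
apply: (dpath_cons li Eg m p0 p1) => [t t0 tl /=|]; first by rewrite tl.
rewrite big_ord_recl addn0.
have /IH IH' : forall j, (i.+1 <= j <= i.+1 + k)%N -> [/\ 0 < l j, E (g j) & is_I1 (phi j)].
  by move=> j /andP[ij jk]; apply: H; rewrite (ltnW ij) -addSnnS.
have {}/IH' IH' : forall j, (i.+1 <= j < i.+1 + k)%N -> g j (phi j 1) = g j.+1 (phi j.+1 0).
  by move=> j /andP[ij jk]; apply: C; rewrite (ltnW ij) -addSnnS.
set S := (X in dpath E 0 X _) in IH'.
have -> : \sum_(j < k.+1) l (i + lift ord0 j)%N = S.
  by apply: eq_bigr => j _; rewrite /= /bump /= add1n addSnnS.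
have S0 := dpath_lt IH'.
apply: (@dpath_eq _ _ _ _ (moore_from l g phi k i.+1 \o (fun t => 1 * t + - l i))).
  (* At the breakpoint [t = l i], [moore_from] evaluates the earlier piece and the shifted tail the
     later one; [C] reconciles them. *)
  move=> t lt_ tS /=; rewrite mul1r; case: leP => // tl.
  have {t lt_ tS tl} -> : t = l i by lra.
  rewrite subrr moore_from0// divff ?gt_eqF// clamp_id// C// leqnn /=.
  by rewrite addnS ltnS leq_addr.
apply: dpath_comp IH' _ _ _ _; [lra|exact: mono_ivp_affine|lra|lra].
Qed.

(** The lengths are those of the subdivision intervals, and each [psi] becomes an element of [I(1)]
    after an affine change of its source interval to [[0,1]]. *)
Lemma moore_from_dpath (T : Type) (E : set (RR -> T)) a b gam : dpath E a b gam ->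
  exists k l g phi, [/\ (forall j, (j < k.+1)%N -> [/\ 0 < l j, E (g j) & is_I1 (phi j)]),
    (forall j, (j < k)%N -> g j (phi j 1) = g j.+1 (phi j.+1 0)),
    \sum_(j < k.+1) l j = b - a
  & forall t, a <= t -> t <= b -> gam t = moore_from l g phi k 0 (t - a)].
Proof.
have piece (x y : RR) psi : x < y -> mono_ivp x y psi -> 0 <= psi x -> psi y <= 1 ->
    is_I1 (fun s => psi ((y - x) * s + x)).
  move=> xy m p0 p1; have yx : 0 < y - x by lra.
  have m' : mono_ivp 0 1 (fun s => psi ((y - x) * s + x)).
    apply: (@mono_ivp_comp 0 1 x y psi (fun s => (y - x) * s + x)) => //.
    + exact: mono_ivp_affine.
    + by rewrite mulr0 add0r.
    + by rewrite mulr1 subrK.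
  split; first exact: mono_ivp_continuous.
  - by move=> s t /andP[s0 s1] /andP[t0 t1] st; apply: m'.1.
  - move=> _ [s /andP[s0 s1] <-]; rewrite /I01 /=; apply/andP; split.
    + apply: le_trans p0 _; have := m'.1 0 s (lexx _) s0 s1.
      by rewrite mulr0 add0r.
    + apply: le_trans p1; have := m'.1 s 1 s0 s1 (lexx _).
      by rewrite mulr1 subrK.
have pieceE (x y t : RR) : x < y -> x <= t -> t <= y ->
    (y - x) * clamp ((t - x) / (y - x)) + x = t.
  move=> xy xt ty; have yx : 0 < y - x by lra.
  rewrite clamp_id ?divr_ge0 ?ler_pdivrMr ?mul1r//; try lra.
  by rewrite mulrC divfK ?gt_eqF// subrK.
elim=> {a b gam} [a b gam p psi ab Ep m p0 p1 g|a c b gam p psi ac Ep m p0 p1 g h].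
  exists 0%N, (fun=> b - a), (fun=> p), (fun _ s => psi ((b - a) * s + a)).
  split=> //; [move=> _ _; split=> //; [lra|exact: piece]|by rewrite big_ord1|].
  by move=> t ta tb /=; rewrite pieceE// g.
move=> [k [l [gg [phi [H C S M]]]]]; have cb := dpath_lt h.
exists k.+1, (fun j => if j is j'.+1 then l j' else c - a),
  (fun j => if j is j'.+1 then gg j' else p),
  (fun j => if j is j'.+1 then phi j' else fun s => psi ((c - a) * s + a)).
have [l0 _ _] := H 0%N isT.
split.
- case=> [_|j jk]; last exact: H.
  by split=> //; [lra|exact: piece].
- case=> [_|j jk]; last exact: C.
  (* Matching of the first two pieces is read off from the two descriptions of [gam c]. *)
  have := M c (lexx _) (ltW cb); rewrite subrr moore_from0// => <-.
  by rewrite mulr1 subrK g//; exact: ltW.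
- by rewrite big_ord_recl /= S; lra.
- move=> t ta tb /=; rewrite lerD2r; case: leP => tc; first by rewrite pieceE// g.
  rewrite (moore_from_shift (l := l) (g := gg) (phi := phi))// M//; last exact: ltW.
  by congr moore_from; lra.
Qed.

Lemma Sp_pathsP (X : mdspace) (gam : RR -> X) : Sp_paths X gam <->
  (exists x, gam = fun=> x) \/
  (dpath (md_exec X) 0 1 gam /\ forall t, gam t = gam (clamp t)).
Proof.
split=> [[?|[n [l [g [phi [n0 H S C ->]]]]]]|[?|[h gc]]]; [by left| |by left|].
  case: n n0 H S C => // n _ H S C.
  right; split; last by move=> t; rewrite /moore clamp_clamp.
  rewrite -S; apply: (@dpath_eq _ _ _ _ (moore_from l g phi n 0)).
    by rewrite S => t t0 t1; rewrite /moore/= clamp_id.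
  apply: (@dpath_moore_from _ _ _ _ _ n 0) => j; rewrite add0n => /andP[_ jn].
    exact: H.
  exact: C.
right; have [k [l [g [phi [H C S M]]]]] := moore_from_dpath h.
exists k.+1, l, g, phi; split=> //; first by rewrite S subr0.
by apply/funext => t; rewrite gc M ?clamp_ge0 ?clamp_le1// subr0.
Qed.

(** * Cell paths *)

Inductive gen (T : Type) (E : set (RR -> T)) : (RR -> T) -> Prop :=
| gen_base g : E g -> gen E g
| gen_reparam g phi : gen E g -> is_M11 phi -> gen E (reparam g phi)
| gen_comp g1 g2 : gen E g1 -> gen E g2 -> g1 1 = g2 0 -> gen E (ncomp g1 g2).

Lemma gen_sub (T : Type) (E F : set (RR -> T)) : E `<=` gen F -> gen E `<=` gen F.
Proof.
move=> EF g; elim=> {g} [g /EF//|g phi _ ? ?|g1 g2 _ ? _ ? ?]; first exact: gen_reparam.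
exact: gen_comp.
Qed.

Lemma gen_image (S T : Type) (f : S -> T) (E : set (RR -> S)) g :
  gen E g -> gen [set f \o e | e in E] (f \o g).
Proof.
elim=> {g} [g Eg|g phi _ ? ?|g1 g2 _ h1 _ h2 e]; first by apply: gen_base; exists g.
  exact: (@gen_reparam _ _ (f \o g)).
have -> : f \o ncomp g1 g2 = ncomp (f \o g1) (f \o g2).
  by apply/funext => t; rewrite /ncomp /=; case: ifP.
by apply: gen_comp => //=; rewrite e.
Qed.

Lemma gen_exec (X : mdspace) (E : set (RR -> X)) :
  E `<=` md_exec X -> gen E `<=` md_exec X.
Proof.
move=> EX g; elim=> {g} [g /EX//|g phi _ ? ?|g1 g2 _ ? _ ? ?].
  exact: md_exec_reparam.
exact: md_exec_comp.
Qed.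

Lemma M11_surj (phi : RR -> RR) y : is_M11 phi -> 0 <= y -> y <= 1 ->
  exists x, [/\ 0 <= x, x <= 1 & phi x = y].
Proof.
move=> [_ _ ps] y0 y1; have : I01 y by rewrite /I01/= y0.
by rewrite -ps => -[x /andP[x0 x1] xy]; exists x.
Qed.

Lemma M11_I01 (phi : RR -> RR) t : is_M11 phi -> 0 <= t -> t <= 1 ->
  0 <= phi t /\ phi t <= 1.
Proof.
move=> [_ _ ps] t0 t1; have : (phi @` I01) (phi t) by exists t => //; rewrite /I01/= t0.
by rewrite ps => /andP[].
Qed.

Lemma M11_mono (phi : RR -> RR) s t : is_M11 phi -> 0 <= s -> s <= t -> t <= 1 ->
  phi s <= phi t.
Proof. by move=> [_ pm _] s0 st t1; apply: pm => //; apply/andP; split; lra. Qed.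

Lemma M11_0 (phi : RR -> RR) : is_M11 phi -> phi 0 = 0.
Proof.
move=> M; have [x [x0 x1 px]] := M11_surj M (lexx 0) ler01.
have := M11_mono M (lexx 0) x0 x1; have [] := M11_I01 M (lexx 0) ler01.
by rewrite px => h _ h'; apply/eqP; rewrite eq_le h h'.
Qed.

Lemma M11_1 (phi : RR -> RR) : is_M11 phi -> phi 1 = 1.
Proof.
move=> M; have [x [x0 x1 px]] := M11_surj M ler01 (lexx 1).
have := M11_mono M x0 x1 (lexx 1); have [] := M11_I01 M ler01 (lexx 1).
by rewrite px => _ h h'; apply/eqP; rewrite eq_le h h'.
Qed.

Lemma M11_id : is_M11 id.
Proof.
split=> //; first by apply: continuous_subspaceT => x; exact: cvg_id.
by rewrite image_id.
Qed.

Lemma M11_mono_ivp (phi : RR -> RR) : is_M11 phi -> mono_ivp 0 1 phi.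
Proof.
move=> M; split=> [s t s0 st t1|y]; first exact: M11_mono.
by rewrite M11_0// M11_1//; exact: M11_surj.
Qed.

(** The combinatorial residue of a cellular structure: [C] plays the role of the closed arcs
    [delta_z] of all cells, [z] interior to the disk. By the last clause the open arcs are simple
    and pairwise disjoint. *)
Definition cell_paths (X : mdspace) (C : set (RR -> X)) : Prop :=
  [/\ C `<=` md_exec X, md_exec X `<=` gen C,
      (forall x, ~ md_states X x -> exists p t, [/\ C p, 0 < t < 1 & p t = x]),
      (forall p t, C p -> 0 < t < 1 -> ~ md_states X (p t))
    & (forall p p' t t', C p -> C p' -> 0 < t < 1 -> 0 < t' < 1 ->
         p t = p' t' -> p = p' /\ t = t')].

(* Cell paths end at states, so a concatenation of cell paths can only meet the
   interior of [g] by running through all of [g]. *)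
Lemma gen_traverses (X : mdspace) (C : set (RR -> X)) (gam g : RR -> X) (t s : RR) :
  cell_paths C -> gen C gam -> C g -> 0 <= t -> t <= 1 -> 0 < s < 1 -> gam t = g s ->
  exists a b chi, [/\ 0 <= a, a < b & b <= 1] /\
    [/\ (forall u v, a <= u -> u <= v -> v <= b -> chi u <= chi v),
        (forall y, 0 <= y -> y <= 1 -> exists u, [/\ a <= u, u <= b & chi u = y])
      & (forall u, a <= u -> u <= b -> gam u = g (chi u))].
Proof.
move=> [CX _ _ Cs Cd] G Cg + + s01; elim: G t => {gam}
    [p Cp|gam phi _ IH M|g1 g2 _ IH1 _ IH2 e12] t t0 t1.
- move=> pt; have [e0 e1] := md_exec_ends (CX _ Cp); have ng := Cs _ _ Cg s01.
  have tn0 : t != 0 by apply/eqP => t00; apply: ng; rewrite -pt t00.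
  have tn1 : t != 1 by apply/eqP => t11; apply: ng; rewrite -pt t11.
  have t01 : 0 < t < 1 by rewrite !lt_neqAle t0 t1 tn1 eq_sym tn0.
  have [-> _] := Cd _ _ _ _ Cp Cg t01 s01 pt.
  by exists 0, 1, id; split; split=> // y y0 y1; exists y.
- rewrite /reparam clamp_id//; have [p0 p1] := M11_I01 M t0 t1.
  move=> /(IH _ p0 p1)[a [b [chi [[a0 ab b1] [cm cs ce]]]]].
  have [a1 b0] : a <= 1 /\ 0 <= b by lra.
  have [a' [a'0 a'1 pa]] := M11_surj M a0 a1.
  have [b' [b'0 b'1 pb]] := M11_surj M b0 b1.
  have ab' : a' < b'.
    by rewrite ltNge; apply/negP => /(fun h => M11_mono M b'0 h a'1); lra.
  have pin u : a' <= u -> u <= b' -> a <= phi u /\ phi u <= b.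
    by move=> ua ub; rewrite -pa -pb; split; apply: M11_mono => //; lra.
  exists a', b', (chi \o phi); split; split=> //=.
  + move=> u v ua uv vb; have [? _] := pin u ua ltac:(lra).
    have [_ ?] := pin v ltac:(lra) vb.
    by apply: cm => //; apply: M11_mono => //; lra.
  + move=> y y0 y1; have [u [au ub uy]] := cs y y0 y1.
    have [v [v0 v1 vu]] := M11_surj M (le_trans a0 au) (le_trans ub b1).
    (* The preimage [v] of [u] may lie outside [[a',b']]; then [u] is [a] or [b], and the
       corresponding endpoint serves instead. *)
    have [va|av] := ltP v a'.
      exists a'; split=> //; first exact: ltW.
      have := M11_mono M v0 (ltW va) a'1; rewrite pa vu => ua.
      by rewrite -uy; congr chi; lra.
    have [bv|vb] := ltP b' v; last by exists v; rewrite vu.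
    exists b'; split=> //; first exact: ltW.
    have := M11_mono M b'0 (ltW bv) v1; rewrite pb vu => ua.
    by rewrite -uy; congr chi; lra.
  + move=> u ua ub; rewrite clamp_id; [|lra|lra].
    by have [? ?] := pin u ua ub; apply: ce.
- rewrite /ncomp clamp_id//; case: leP => [th|th].
    move=> /(IH1 (2 * t) ltac:(lra) ltac:(lra))[a [b [chi [[a0 ab b1] [cm cs ce]]]]].
    exists (a / 2), (b / 2), (fun u => chi (2 * u)); split; split; try lra.
    + by move=> u v ua uv vb; apply: cm; lra.
    + move=> y y0 y1; have [u [au ub uy]] := cs y y0 y1.
      by exists (u / 2); split; [lra|lra|rewrite -uy; congr chi; lra].
    + move=> u ua ub; rewrite clamp_id; [|lra|lra].
      by case: leP => uh; [apply: ce; lra|exfalso; lra].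
  move=> /(IH2 (2 * t - 1) ltac:(lra) ltac:(lra))[a [b [chi [[a0 ab b1] [cm cs ce]]]]].
  exists ((a + 1) / 2), ((b + 1) / 2), (fun u => chi (2 * u - 1)); split; split; try lra.
  + by move=> u v ua uv vb; apply: cm; lra.
  + move=> y y0 y1; have [u [au ub uy]] := cs y y0 y1.
    by exists ((u + 1) / 2); split; [lra|lra|rewrite -uy; congr chi; lra].
  + move=> u ua ub; rewrite clamp_id; [|lra|lra].
    (* At the junction [u = 1/2] the concatenation is computed by [g1], hence the appeal to
       [g1 1 = g2 0]. *)
    case: leP => uh; last by apply: ce; lra.
    rewrite -ce; [|lra|lra].
    have -> : 2 * u = 1 by lra.
    by rewrite subrr.
Qed.

(** * Directedness of the inverse of a bijective map *)

Section InverseOfBijectiveMap.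
Variables (X Y : mdspace) (f : X -> Y) (h : Y -> X).
Variables (CX : set (RR -> X)) (CY : set (RR -> Y)).
Hypotheses (fm : mdmap f) (fK : cancel f h) (hK : cancel h f).
Hypotheses (cX : cell_paths CX) (cY : cell_paths CY).

Lemma inverse_cell_path g : CY g -> exists p psi,
  [/\ CX p, mono_ivp 0 1 psi, 0 <= psi 0, psi 1 <= 1
    & forall t, 0 <= t -> t <= 1 -> h (g t) = p (psi t)].
Proof.
move=> Cg; have h01 : 0 < (1 / 2 : RR) < 1 by lra.
have [_ _ Xp _ Xd] := cX; have [_ Yg _ Ys _] := cY; have [_ fs fe] := fm.
have [p [t [Cp t01 pt]]] : exists p t, [/\ CX p, 0 < t < 1 & p t = h (g (1 / 2))].
  by apply: Xp => /fs; rewrite hK; exact: Ys.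
have fpt : (f \o p) t = g (1 / 2) by rewrite /= pt hK.
have Ep : md_exec X p by case: cX => + _ _ _ _; apply.
have /andP[t0 t1] := t01.
have [a [b [chi [[a0 ab b1] [cm cs ce]]]]] :=
  gen_traverses cY (Yg _ (fe _ Ep)) Cg (ltW t0) (ltW t1) h01 fpt.
(* [f \o p] is injective on ]0,1[, so [chi] is constant on no subinterval. *)
have clt u v : a <= u -> u < v -> v <= b -> chi u < chi v.
  move=> au uv vb; rewrite lt_neqAle cm ?(ltW uv)// andbT; apply/eqP => cuv.
  (* The points at one and two thirds lie in []0,1[] even when [u = 0] or [v = 1]; at the ends [p]
     may fail to be injective, for instance on a loop. *)
  pose u1 := u + (v - u) / 3; pose v1 := u + 2 * (v - u) / 3.
  have [uu1 u1v1 v1v] : [/\ u < u1, u1 < v1 & v1 < v] by rewrite /u1 /v1; split; lra.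
  have h1 := cm u u1 au (ltW uu1) ltac:(lra).
  have h2 := cm u1 v1 ltac:(lra) (ltW u1v1) ltac:(lra).
  have h3 := cm v1 v ltac:(lra) (ltW v1v) vb.
  have e1 : chi u1 = chi v1 by lra.
  have : f (p u1) = f (p v1).
    by rewrite -[f (p u1)]/((f \o p) u1) -[f (p v1)]/((f \o p) v1) !ce ?e1//; lra.
  have [u1i v1i] : 0 < u1 < 1 /\ 0 < v1 < 1 by lra.
  move=> /(can_inj fK) /(Xd _ _ _ _ Cp Cp u1i v1i)[_]; lra.
have cinj u v : a <= u -> u <= b -> a <= v -> v <= b -> chi u = chi v -> u = v.
  move=> au ub av vb e; have [uv|vu|//] := ltgtP u v.
    by have := clt u v au uv vb; lra.
  by have := clt v u av vu ub; lra.
(* [psi] is the inverse of [chi], with arbitrary values outside [[0,1]]. *)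
have /choice[psi psiP] : forall y, exists u, 0 <= y <= 1 ->
    [/\ a <= u, u <= b & chi u = y].
  move=> y; have [/andP[y0 y1]|ny] := boolP (0 <= y <= 1); last by exists 0.
  by have [u ?] := cs y y0 y1; exists u.
have [p0a p0b p0e] := psiP 0 ltac:(lra); have [p1a p1b p1e] := psiP 1 ltac:(lra).
exists p, psi; split; [by []| |lra|lra|].
- split=> [s u s0 su u1|y y0 y1].
    have [sa sb se] := psiP s ltac:(lra); have [ua ub ue] := psiP u ltac:(lra).
    by rewrite leNgt; apply/negP => us; have := clt _ _ ua us sb; lra.
  (* By injectivity of [chi], [psi] takes the value [y] at [chi y]. *)
  have c0 := cm _ y p0a y0 ltac:(lra); have c1 := cm y _ ltac:(lra) y1 p1b.
  have [ca cb cc] := psiP (chi y) ltac:(lra).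
  by exists (chi y); split; [lra|lra|apply: cinj => //; lra].
- move=> u u0 u1; have [ua ub ue] := psiP u ltac:(lra).
  by have := ce _ ua ub; rewrite ue /= => <-; rewrite fK.
Qed.

Lemma inverse_gen_dpath g : gen CY g -> dpath (md_exec X) 0 1 (h \o g).
Proof.
elim=> {g} [g /inverse_cell_path [p [psi [Cp m p0 p1 e]]]|g phi _ IH M|g1 g2 _ IH1 _ IH2 e].
- have Ep : md_exec X p by case: cX => + _ _ _ _; apply.
  exact: (dpath_one ltr01 Ep m p0 p1).
- apply: (@dpath_eq _ _ _ _ ((h \o g) \o phi)).
    by move=> t t0 t1; rewrite /reparam /= clamp_id.
  by apply: (dpath_comp IH ltr01 (M11_mono_ivp M)); rewrite ?M11_0// M11_1.
- apply: (@dpath_cat _ _ _ (1 / 2)).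
    apply: (@dpath_eq _ _ _ _ ((h \o g1) \o (fun t => 2 * t + 0))).
      move=> t t0 t1; rewrite /ncomp /= clamp_id; [|lra|lra].
      by rewrite t1 addr0.
    by apply: (dpath_comp IH1); [lra|apply: mono_ivp_affine; lra|lra|lra].
  apply: (@dpath_eq _ _ _ _ ((h \o g2) \o (fun t => 2 * t + (- 1)))).
    move=> t t0 t1; rewrite /ncomp /= clamp_id; [|lra|lra].
    case: leP => // th; have -> : t = 1 / 2 by lra.
    have -> : 2 * (1 / 2) = 1 :> RR by lra.
    by rewrite subrr e.
  by apply: (dpath_comp IH2); [lra|apply: mono_ivp_affine; lra|lra|lra].
Qed.

Lemma inverse_Sp_paths gam : Sp_paths Y gam -> Sp_paths X (h \o gam).
Proof.
move=> /Sp_pathsP[[x ->]|[d gc]]; apply/Sp_pathsP; first by left; exists (h x).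
right; split; last by move=> t /=; rewrite gc.
have base a b (gam' p : RR -> Y) psi : a < b -> md_exec Y p -> mono_ivp a b psi ->
    0 <= psi a -> psi b <= 1 -> (forall t, a <= t -> t <= b -> gam' t = p (psi t)) ->
    dpath (md_exec X) a b (h \o gam').
  move=> ab Ep m p0 p1 e; apply: (@dpath_eq _ _ _ _ ((h \o p) \o psi)).
    by move=> t ta tb /=; rewrite e.
  by apply: dpath_comp ab m p0 p1; apply: inverse_gen_dpath; case: cY => _ + _ _ _; apply.
elim: d => {gc gam} [a b gam p psi *|a c b gam p psi ? ? ? ? ? ? _ IH].
  exact: (base _ _ _ p psi).
by apply: dpath_cat IH; exact: (base _ _ _ p psi).
Qed.

End InverseOfBijectiveMap.

Lemma mdmap_Sp_paths (X Y : mdspace) (f : X -> Y) gam : mdmap f ->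
  Sp_paths X gam -> Sp_paths Y (f \o gam).
Proof.
move=> [_ _ fe] [[x ->]|[n [l [g [phi [n0 H S C ->]]]]]]; first by left; exists (f x).
right; exists n, l, (fun j => f \o g j), phi; split=> //.
- by move=> i /H[? ? ?]; split=> //; exact: fe.
- by move=> i /C /= ->.
- by apply/funext => t; exact: (moore_from_comp f).
Qed.

(** The two conditions differ only in whether the continuous inverse preserves directed paths, which
    [inverse_Sp_paths] gives for every inverse of [f]. *)
Lemma homeomorphism_Sp_iso (X Y : mdspace) (f : X -> Y) CX CY : mdmap f ->
  @cell_paths X CX -> @cell_paths Y CY -> homeomorphism f <-> Sp_iso f.
Proof.
move=> fm cX cY; split=> [[fc [h [hc fK hK]]]|[[fc _] [h [[hc _] fK hK]]]].
  split; first by split=> // g; exact: mdmap_Sp_paths fm.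
  exists h; split=> //; split=> // g.
  exact: (inverse_Sp_paths fm fK hK cX cY).
by split=> //; exists h.
Qed.

(** * Indiscrete multipointed d-spaces *)

Definition indiscrete (T : choiceType) : Type := T.
HB.instance Definition _ (T : choiceType) := Choice.on (indiscrete T).

Section Indiscrete.
Variable T : choiceType.

Definition indiscrete_open : set_system (indiscrete T) := [set A | A = set0 \/ A = setT].

Lemma indiscrete_openT : indiscrete_open setT.
Proof. by right. Qed.

Lemma indiscrete_openI : setI_closed indiscrete_open.
Proof.
by move=> A B [->|->] [->|->]; rewrite /indiscrete_open/= ?set0I ?setI0 ?setIT; tauto.
Qed.

Lemma indiscrete_open_bigU (I : Type) (f : I -> set (indiscrete T)) :
  (forall i, indiscrete_open (f i)) -> indiscrete_open (\bigcup_i f i).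
Proof.
move=> fo; have [[i fi]|nf] := pselect (exists i, f i = setT).
  by right; apply/seteqP; split=> // x _; exists i => //; rewrite fi.
left; apply/seteqP; split=> // x [i _]; case: (fo i) => [->//|fi].
by case: nf; exists i.
Qed.

HB.instance Definition _ := isOpenTopological.Build (indiscrete T)
  indiscrete_openT indiscrete_openI indiscrete_open_bigU.

Lemma continuous_indiscrete (S : topologicalType) (f : S -> indiscrete T) : continuous f.
Proof.
apply/continuousP => A [->|->]; first by rewrite preimage_set0; exact: open0.
by rewrite preimage_setT; exact: openT.
Qed.

(** If [U] contains [x] but not [y], the path equal to [x] for [t <= 0] and to [y] afterwards is
    continuous, yet it pulls [U] back to [{0}] in [[0,1]], which is not open there. *)
Lemma indiscrete_delta_generated : delta_generated (indiscrete T).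
Proof.
move=> U HU; have [[x Ux]|/forallNP nU] := pselect (exists x, U x); last first.
  by left; apply/seteqP; split=> // x /nU.
right; apply/seteqP; split=> // y _; apply: contrapT => Uy.
have [|W [Wo]] := HU (fun t => if t <= 0 then x else y).
  exact: continuous_indiscrete.
move=> /seteqP[WU UW]; have [|W0 _] := UW 0.
  by split; rewrite /= ?lexx// /I01/= lexx ler01.
have /nbhs_ballP[e /= e0 eW] := open_nbhs_nbhs (conj Wo W0).
pose t : RR := Num.min (e / 2) 1.
have t0 : 0 < t by rewrite lt_min divr_gt0// ltr01.
have t1 : t <= 1 by rewrite ge_min lexx orbT.
have te : t < e by rewrite gt_min ltr_pdivrMr// ltr_pMr// ltr1n.
have [] := WU t; last by rewrite /= leNgt t0.
split; last by rewrite /I01/= ltW.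
by apply: eW; rewrite /ball/= sub0r normrN gtr0_norm.
Qed.

(** Every function from a multipointed d-space into this one is a map, so universal properties can
    be tested on bare sets. *)
Definition indiscrete_md : mdspace.
Proof.
apply: (@MDSpace (indiscrete T) setT [set g | forall t, g t = g (clamp t)]).
- exact: indiscrete_delta_generated.
- by move=> g gc; split=> //; exact: continuous_indiscrete.
- by [].
- by move=> g phi _ _ t; rewrite /reparam clamp_clamp.
- by move=> g1 g2 _ _ _ t; rewrite /ncomp clamp_clamp.
Defined.

Lemma mdmap_indiscrete (X : mdspace) (f : X -> indiscrete_md) : mdmap f.
Proof.
split=> //; first exact: continuous_indiscrete.
by move=> g /md_exec_path[_ gc] t /=; rewrite gc.
Qed.

End Indiscrete.

(** The same space with fewer states and execution paths. When the legs of a universal cocone on [X]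
    factor through it, [X] has no other states or paths. *)
Definition restrict_md (X : mdspace) (S : set X) (E : set (RR -> X)) :
  E `<=` md_exec X -> (forall g, E g -> S (g 0) /\ S (g 1)) -> mdspace.
Proof.
move=> EX ES; apply: (@MDSpace X S (gen E)).
- exact: md_dgen.
- by move=> g /(gen_exec EX); exact: md_exec_path.
- move=> g; elim=> {g} [g /ES//|g phi _ [? ?] M|g1 g2 _ [h0 _] _ [_ h1] _].
    by rewrite /reparam !clamp_id// M11_0// M11_1.
  rewrite /ncomp !clamp_id//= mulr0 mulr1 ifT; last lra.
  by rewrite ifF; [have -> : 2 - 1 = 1 :> RR by lra|apply/negbTE; rewrite -ltNge; lra].
- by move=> g phi; exact: gen_reparam.
- by move=> g1 g2; exact: gen_comp.
Defined.

Lemma mdmap_comp (X Y Z : mdspace) (g : Y -> Z) (f : X -> Y) :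
  mdmap g -> mdmap f -> mdmap (g \o f).
Proof.
move=> [gc gs ge] [fc fs fe]; split=> [x|x /fs /gs//|p /fe /ge//].
by apply: continuous_comp; [exact: fc|exact: gc].
Qed.

Lemma mdmap_id (X : mdspace) : mdmap (@id X).
Proof. by split=> // x; exact: cvg_id. Qed.

(** * Pushouts and colimits *)

Section Pushout.
Variables (A B1 B2 P : mdspace) (f1 : A -> B1) (f2 : A -> B2).
Variables (i1 : B1 -> P) (i2 : B2 -> P).
Hypothesis po : is_pushout f1 f2 i1 i2.

Lemma pushout_eq (W : mdspace) (h h' : P -> W) : mdmap h -> mdmap h' ->
  h \o i1 = h' \o i1 -> h \o i2 = h' \o i2 -> h = h'.
Proof.
have [m1 m2 e U] := po; move=> mh mh' e1 e2.
have [|k [_ _ _ u]] := U _ _ _ (mdmap_comp mh m1) (mdmap_comp mh m2).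
  exact: (congr1 (fun k => h \o k) e).
by rewrite (u h)// (u h').
Qed.

(** The indicator of the union of the two images and the constant [true] agree on both legs, hence
    coincide by uniqueness. *)
Lemma pushout_surj y : range i1 y \/ range i2 y.
Proof.
pose h (y : P) : indiscrete_md bool := `[< range i1 y \/ range i2 y >].
suff /(congr1 (fun k => k y)) : h = fun=> true by move=> /asboolP.
apply: pushout_eq; try exact: mdmap_indiscrete.
- by apply/funext => x; apply/asboolP; left; exists x.
- by apply/funext => x; apply/asboolP; right; exists x.
Qed.

(* The identity factors through [P] with the generated paths and states. *)
Lemma pushout_gen :
  md_exec P `<=` gen ([set i1 \o g | g in md_exec B1] `|` [set i2 \o g | g in md_exec B2]) /\
  md_states P `<=` (i1 @` md_states B1) `|` (i2 @` md_states B2).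
Proof.
have [[c1 s1 e1] [c2 s2 e2] e U] := po.
set E := (X in gen X); set S := (X in _ /\ _ `<=` X).
have EP : E `<=` md_exec P by move=> _ [[g /e1 + <-]|[g /e2 + <-]].
have ES g : E g -> S (g 0) /\ S (g 1).
  case=> -[k /md_exec_ends[k0 k1] <-].
    by split; left; [exists (k 0)|exists (k 1)].
  by split; right; [exists (k 0)|exists (k 1)].
pose Q := restrict_md EP ES.
have [|||h [[hc hs he] h1 h2 _]] := U Q i1 i2.
- split=> [//|x ?|g ?]; first by left; exists x.
  by apply: gen_base; left; exists g.
- split=> [//|x ?|g ?]; first by right; exists x.
  by apply: gen_base; right; exists g.
- exact: e.
have hid : h = id :> (P -> P).
  apply: (@pushout_eq P h id) => //; last exact: mdmap_id.
  split=> [//|x /hs [] [z sz <-]|g /he]; [exact: s1|exact: s2|exact: gen_exec].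
by rewrite hid in hs he; split=> [g /he|x /hs].
Qed.

End Pushout.

Section Colimit.
Variables (O : Type) (le : O -> O -> Prop) (P : set O) (D : O -> mdspace).
Variables (m : forall i j, D i -> D j) (C : mdspace) (c : forall i, D i -> C).
Arguments c : clear implicits.
Hypothesis co : is_colimit le P D m C c.

Lemma colimit_eq (W : mdspace) (h h' : C -> W) : mdmap h -> mdmap h' ->
  (forall i, P i -> h \o c i = h' \o c i) -> h = h'.
Proof.
have [cm cc U] := co; move=> mh mh' e.
have [||k [_ _ u]] := U W (fun i => h \o c i).
- by move=> i Pi; apply: mdmap_comp => //; exact: cm.
- by move=> i j Pi Pj ij; exact: (congr1 (fun k => h \o k) (cc i j Pi Pj ij)).
by rewrite (u h)// (u h')// => i Pi; rewrite e.
Qed.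

Lemma colimit_surj y : exists i x, P i /\ c i x = y.
Proof.
pose h (y : C) : indiscrete_md bool := `[< exists i x, P i /\ c i x = y >].
suff /(congr1 (fun k => k y)) : h = fun=> true by move=> /asboolP.
apply: colimit_eq; try exact: mdmap_indiscrete.
by move=> i Pi; apply/funext => x; apply/asboolP; exists i, x.
Qed.

(** As for pushouts: the cocone factors through the restricted structure, and the induced map is the
    identity by uniqueness. *)
Lemma colimit_gen :
  md_exec C `<=` gen [set p | exists i g, [/\ P i, md_exec (D i) g & p = c i \o g]] /\
  md_states C `<=` [set y | exists i x, [/\ P i, md_states (D i) x & y = c i x]].
Proof.
have [cm cc U] := co.
set E := (X in gen X); set S := (X in _ /\ _ `<=` X).
have EC : E `<=` md_exec C by move=> _ [i [g [/cm[_ _ +] Eg ->]]]; apply.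
have ES g : E g -> S (g 0) /\ S (g 1).
  by move=> [i [{}g [Pi /md_exec_ends[? ?] ->]]]; split; [exists i, (g 0)|exists i, (g 1)].
pose Q := restrict_md EC ES.
have [||h [[hc hs he] hi _]] := U Q c.
- move=> i Pi; have [? _ _] := cm i Pi; split=> [//|x ?|g ?]; first by exists i, x.
  by apply: gen_base; exists i, g.
- exact: cc.
have hid : h = id :> (C -> C).
  apply: (@colimit_eq C h id) => //; last exact: mdmap_id.
  split=> [//|x /hs [i [z [Pi sz ->]]]|g /he]; last exact: gen_exec.
  by have [_ + _] := cm i Pi; apply.
by rewrite hid in hs he; split=> [g /he|x /hs].
Qed.

End Colimit.

(** * Globular cells and towers *)

Lemma glob_point n (Z : set 'rV[RR]_n) (G : mdspace) q e (y : G) : is_glob Z q e ->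
  (exists b, y = q b) \/ (exists z t, [/\ Z z, 0 < t < 1 & y = e z t]).
Proof.
move=> [_ e01 _ _ [_ + _ _ _]] => /(_ y)[|[z [t [Zz /andP[t0 t1] ->]]]]; first by left.
have [E0 E1] := e01 z Zz.
have [t00|tn0] := eqVneq t 0; first by left; exists false; rewrite t00.
have [t11|tn1] := eqVneq t 1; first by left; exists true; rewrite t11.
by right; exists z, t; rewrite !lt_neqAle t0 t1 tn1 eq_sym tn0.
Qed.

Lemma sphere_disk n : sphere n `<=` disk n.
Proof. by move=> z; rewrite /sphere /disk /= => ->. Qed.

(** The effect of gluing one globe, stripped of topology: the open arcs of [C] are simple, pairwise
    disjoint, and cover exactly the complement of the image of [A]. *)
Definition attaches (A B : mdspace) (m : A -> B) (C : set (RR -> B)) : Prop :=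
  [/\ injective m, C `<=` md_exec B,
      md_exec B `<=` gen ([set m \o g | g in md_exec A] `|` C),
      md_states B `<=` m @` md_states A
    & [/\ (forall y, range m y \/ exists p t, [/\ C p, 0 < t < 1 & p t = y]),
      (forall p t, C p -> 0 < t < 1 -> ~ range m (p t))
    & (forall p p' t t', C p -> C p' -> 0 < t < 1 -> 0 < t' < 1 ->
         p t = p' t' -> p = p' /\ t = t')]].

(** As a set, the pushout is [A] together with the part of [GD] outside the image of [iota]. Maps
    into an indiscrete space on [A + GD] separate these points. *)
Lemma pushout_glob_attaches n (GS GD A B : mdspace) qS eS qD eD
    (iota : GS -> GD) (a : GS -> A) (m : A -> B) (b : GD -> B) :
  is_glob (sphere n) qS eS -> is_glob (disk n) qD eD ->
  (forall bb, iota (qS bb) = qD bb) ->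
  (forall z t, sphere n z -> I01 t -> iota (eS z t) = eD z t) ->
  mdmap a -> is_pushout a iota m b -> exists C, attaches m C.
Proof.
move=> gS gD iq ie [_ as_ ae] po.
have [_ _ qDn eDinj [eDq _ _ sD xD]] := gD; have [_ _ _ _ [_ _ _ sS xS]] := gS.
have [mm [_ bs be] mb U] := po.
have I01W (t : RR) : 0 < t < 1 -> I01 t.
  by move=> /andP[? ?]; rewrite /I01/= !ltW.
have iinj : injective iota.
  move=> s s'.
  have [[b0 ->]|[z [t [Zz t01 ->]]]] := glob_point s gS;
  have [[b1 ->]|[z' [t' [Zz' t'01 ->]]]] := glob_point s' gS;
  rewrite ?iq ?ie//; try exact: I01W.
  - by case: b0 b1 => -[] // /esym.
  - by move/esym/(eDq _ _ _ (sphere_disk Zz') t'01).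
  - by move/(eDq _ _ _ (sphere_disk Zz) t01).
  - by move/(eDinj _ _ _ _ (sphere_disk Zz) (sphere_disk Zz') t01 t'01) => -[-> ->].
have iout z t : disk n z -> ~ sphere n z -> 0 < t < 1 -> ~ exists s, iota s = eD z t.
  move=> Dz nSz t01 [s]; have [[b0 ->]|[z' [t' [Zz' t'01 ->]]]] := glob_point s gS.
    by rewrite iq => /esym/(eDq _ _ _ Dz t01).
  rewrite ie//; last exact: I01W.
  by move=> /(eDinj _ _ _ _ (sphere_disk Zz') Dz t'01 t01)[zz _]; rewrite -zz in nSz.
pose W := indiscrete_md (A + GD)%type.
pose u (x : A) : W := inl x.
(* Boundary points are sent to [A] through the attaching map, all others stay in [GD]; injectivity
   of [iota] gives compatibility with [u]. *)
pose v (y : GD) : W :=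
  if pselect (exists s, iota s = y) is left e then inl (a (projT1 (cid e))) else inr y.
have [|h [_ hm hb _]] := U W u v (mdmap_indiscrete u) (mdmap_indiscrete v).
  apply/funext => s; rewrite /u /v /=; case: pselect => [e|]; last by case; exists s.
  by case: cid => s' /= /iinj ->.
have {}hm x : h (m x) = inl x by rewrite -[LHS]/((h \o m) x) hm.
have {}hb y : h (b y) = v y by rewrite -[LHS]/((h \o b) y) hb.
have vout z t : disk n z -> ~ sphere n z -> 0 < t < 1 -> v (eD z t) = inr (eD z t).
  by move=> Dz nSz t01; rewrite /v; case: pselect => // e; case: (iout _ _ Dz nSz t01 e).
have t01c (t : RR) : 0 < t < 1 -> clamp t = t.
  by move=> /andP[? ?]; rewrite clamp_id// ltW.
have mbs s : b (iota s) = m (a s) by rewrite -[LHS]/((b \o iota) s) -mb.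
exists [set p | exists z, [/\ disk n z, ~ sphere n z & p = fun t => b (eD z (clamp t))]].
have [Bg Bs] := pushout_gen po.
split.
- by move=> x y /(congr1 h); rewrite !hm => -[].
- move=> _ [z [Dz _ ->]]; apply: (be (fun t => eD z (clamp t))).
  by rewrite xD; exists z, id; split=> //; exact: M11_id.
- apply: subset_trans Bg _; apply: gen_sub => _ [[g Eg <-]|[g Eg <-]].
    by apply: gen_base; left; exists g.
  move: Eg; rewrite xD => -[z [phi [Dz M ->]]].
  have phic t : I01 (phi (clamp t)).
    by have [? ?] := M11_I01 M (clamp_ge0 t) (clamp_le1 t); apply/andP.
  (* Arcs over the boundary sphere are already execution paths of [A]; the others are reparametrised
     arcs of the new cell. *)
  have [Sz|nSz] := pselect (sphere n z).
    apply: gen_base; left; exists (a \o (fun t => eS z (phi (clamp t)))).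
      by apply: ae; rewrite xS; exists z, phi.
    by apply/funext => t /=; rewrite -mbs ie.
  have -> : b \o (fun t => eD z (phi (clamp t))) =
            reparam (fun t => b (eD z (clamp t))) phi.
    apply/funext => t; rewrite /reparam /= [clamp (phi _)]clamp_id//;
      by have /andP[] := phic t.
  by apply: gen_reparam => //; apply: gen_base; right; exists z.
- apply: subset_trans Bs _ => _ [//|[y + <-]]; rewrite sD => -[bb _ <-].
  rewrite -iq mbs; exists (a (qS bb)) => //; apply: as_; rewrite sS.
  by exists bb.
split.
- move=> y; have [|[g _ <-]] := pushout_surj po y; first by left.
  have [[bb ->]|[z [t [Dz t01 ->]]]] := glob_point g gD.
    by left; rewrite -iq mbs; exists (a (qS bb)).
  have [Sz|nSz] := pselect (sphere n z).
    by left; rewrite -(ie _ _ Sz (I01W _ t01)) mbs; exists (a (eS z t)).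
  right; exists (fun t => b (eD z (clamp t))), t; split=> //; first by exists z.
  by rewrite t01c.
- move=> _ t [z [Dz nSz ->]] t01 [x _ /(congr1 h)].
  by rewrite hm hb t01c// vout.
- move=> _ _ t t' [z [Dz nSz ->]] [z' [Dz' nSz' ->]] t01 t'01 /(congr1 h).
  rewrite !hb !t01c// !vout// => -[].
  by move=> /(eDinj _ _ _ _ Dz Dz' t01 t'01)[-> ->].
Qed.

(** * Transfinite composition of cell attachments *)

Section Tower.
Variables (O : Type) (lt : O -> O -> Prop) (D : O -> mdspace).
Variable m : forall i j, D i -> D j.
Variable cell : forall i j : O, set (RR -> D j).
Arguments m : clear implicits.
Arguments cell : clear implicits.
Let le i j := lt i j \/ i = j.
Hypothesis wo : strict_wellorder lt.
Hypothesis m_map : forall i j, le i j -> mdmap (m i j).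
Hypothesis m_id : forall i, m i i = id.
Hypothesis m_comp : forall i j k, le i j -> le j k -> m i k = m j k \o m i j.
Hypothesis m_min : forall i, (forall j, ~ lt j i) -> discrete_md (D i).
Hypothesis m_succ : forall i j, is_succ lt i j -> attaches (m i j) (cell i j).
Hypothesis m_lim : forall i, is_limit_index lt i ->
  is_colimit le (fun j => lt j i) D m (D i) (fun j => m j i).

Lemma tower_le_refl i : le i i. Proof. by right. Qed.

Lemma tower_le_trans i j k : le i j -> le j k -> le i k.
Proof.
have [_ tr _ _] := wo; move=> [ij|->//] [jk|<-]; last by left.
by left; exact: tr jk.
Qed.

Lemma tower_le_total i j : le i j \/ le j i.
Proof.
have [_ _ tot _] := wo; case: (tot i j) => [?|->|?]; [by left; left| |by right; left].
by left; right.
Qed.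

Lemma tower_succ_le i j k : is_succ lt i k -> lt j k -> le j i.
Proof.
have [_ _ tot _] := wo; move=> [_ ik] jk.
by case: (tot i j) => [ij|->|?]; [case: (ik j)|right|left].
Qed.

Definition tower_cells (P : set O) (C : mdspace) (c : forall i, D i -> C) :
    set (RR -> C) :=
  [set q | exists i j p, [/\ P j, is_succ lt i j, cell i j p & q = c j \o p]].

(** The invariant of the transfinite induction, stated for a general cocone so that it covers [D k]
    over the indices up to [k], a limit over the indices below it, and [X] over all of them. The
    last clause says that attaching cells creates no states. *)
Definition stage (P : set O) (C : mdspace) (c : forall i, D i -> C) : Prop :=
  [/\ (forall j, P j -> injective (c j)),
      md_exec C `<=` gen (tower_cells P c),
      (forall x, ~ md_states C x ->
         exists p t, [/\ tower_cells P c p, 0 < t < 1 & p t = x])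
    & (forall j, P j -> md_states C `<=` c j @` md_states (D j))].

(** A retraction of [c i] is built from a cocone into an indiscrete space: a point of [D j] goes to
    the point of [D i] with which it is eventually identified, and to [None] if there is none. *)
Lemma colimit_inj (P : set O) (C : mdspace) (c : forall i, D i -> C) : is_colimit le P D m C c ->
  (forall i j, P i -> P j -> le i j -> injective (m i j)) ->
  forall i, P i -> injective (c i).
Proof.
move=> [_ _ U] minj i Pi.
(* [R j y x] says that [y] and [x] become equal at some later stage; injectivity of the transition
   maps makes [x] unique. *)
pose R j (y : D j) (x : D i) := exists k, [/\ P k, le i k, le j k & m j k y = m i k x].
have Ru j y x x' : P j -> R j y x -> R j y x' -> x = x'.
  move=> Pj [k [Pk ik jk e]] [k' [Pk' ik' jk' e']].
  have [kk|kk] := tower_le_total k k'.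
    apply: (minj i k' Pi Pk' ik'); rewrite -e' (m_comp ik kk) (m_comp jk kk) /=.
    by rewrite e.
  apply: (minj i k Pi Pk ik); rewrite -e (m_comp ik' kk) (m_comp jk' kk) /=.
  by rewrite e'.
pose W := indiscrete_md (option (D i)).
pose d j (y : D j) : W :=
  if pselect (exists x, R j y x) is left e then Some (projT1 (cid e)) else None.
have dE j y x : P j -> R j y x -> d j y = Some x.
  move=> Pj r; rewrite /d; case: pselect => [e|]; last by case; exists x.
  by case: cid => x' r' /=; rewrite (Ru _ _ _ _ Pj r r').
have [||h [_ hc _]] := U W d.
- by move=> *; exact: mdmap_indiscrete.
- move=> j j' Pj Pj' jj; apply/funext => y /=.
  have RR' x : R j' (m j j' y) x <-> R j y x.
    split=> -[k [Pk ik jk e]].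
      by exists k; split=> //; [exact: tower_le_trans jk|rewrite -e (m_comp jj jk)].
    have [kk|kk] := tower_le_total k j'.
      exists j'; split=> //; [exact: tower_le_trans kk|exact: tower_le_refl|].
      by rewrite m_id (m_comp jk kk) (m_comp ik kk) /= e.
    by exists k; split=> //; rewrite -e (m_comp jj kk).
  have [[x r]|n] := pselect (exists x, R j y x).
    by rewrite (dE _ _ x Pj r) (dE _ _ x Pj')//; exact/RR'.
  rewrite /d; case: pselect => [e|_]; last by case: pselect.
  by case: n; case: e => x /RR' r; exists x.
have hx x : h (c i x) = Some x.
  rewrite -[LHS]/((h \o c i) x) hc//; apply: dE => //.
  by exists i; split=> //; exact: tower_le_refl.
by move=> x y /(congr1 h); rewrite !hx => -[].
Qed.

Lemma tower_cells_comp i P (C : mdspace) (c : forall i, D i -> C) p :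
  (forall j, le j i -> P j) ->
  (forall j, le j i -> c i \o m j i = c j) ->
  tower_cells (le^~ i) (fun j => m j i) p -> tower_cells P c (c i \o p).
Proof.
move=> Pd cc [i' [j [q [ji s Cq ->]]]]; exists i', j, q; split=> //; first exact: Pd.
by rewrite -(cc j ji).
Qed.

Lemma stage_colimit (P : set O) (C : mdspace) (c : forall i, D i -> C) : is_colimit le P D m C c ->
  (forall i j, P j -> le i j -> P i) ->
  (forall i, P i -> stage (le^~ i) (fun j => m j i)) -> stage P c.
Proof.
move=> co Pd st; have [cm cc _] := co; have [Cg Cs] := colimit_gen co.
have cellc i p : P i -> tower_cells (le^~ i) (fun j => m j i) p ->
    tower_cells P c (c i \o p).
  move=> Pi; apply: tower_cells_comp => j ji; first exact: Pd ji.
  by apply: cc => //; exact: Pd ji.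
split.
- apply: (colimit_inj co) => i j Pi Pj ij; have [+ _ _ _] := st j Pj; exact.
- apply: subset_trans Cg _; apply: gen_sub => _ [i [g [Pi Eg ->]]].
  have [_ /(_ _ Eg) /(gen_image (c i)) + _ _] := st i Pi.
  apply: gen_sub => _ [p Cp <-]; apply: gen_base; exact: cellc.
- move=> y ny; have [i [x [Pi xy]]] := colimit_surj co y.
  have [_ s _] := cm i Pi; have [_ _ /(_ x) + _] := st i Pi.
  case; first by move=> /s; rewrite xy.
  move=> p [t [Cp t01 pt]]; exists (c i \o p), t; split=> //; first exact: cellc.
  by rewrite /= pt.
- move=> j Pj _ /Cs[i [x [Pi sx ->]]]; have [ij|ji] := tower_le_total i j.
    exists (m i j x); first by have [_ + _] := m_map ij; apply.
    by rewrite -[LHS]/((c j \o m i j) x) cc.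
  have [_ _ _ /(_ j ji _ sx)[z sz <-]] := st i Pi.
  by exists z => //; rewrite -[RHS]/((c i \o m j i) z) cc.
Qed.

(** An index up to [k] is either [k] or at most [i], so the arcs at [k] are the images of those at
    [i] and the arcs of the new cell. *)
Lemma stage_succ i k : is_succ lt i k -> stage (le^~ i) (fun j => m j i) ->
  stage (le^~ k) (fun j => m j k).
Proof.
move=> s [inj g pt sts]; have ik : le i k by left; case: s.
have [ainj aC ag ast [apt _ _]] := m_succ s; have [_ ms _] := m_map ik.
have lek j : le j k -> le j i \/ j = k.
  by move=> [/(tower_succ_le s)|]; [left|right].
have cellm p : tower_cells (le^~ i) (fun j => m j i) p ->
    tower_cells (le^~ k) (fun j => m j k) (m i k \o p).
  apply: tower_cells_comp => j ji; first exact: tower_le_trans ik.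
  by rewrite -m_comp.
have cellk p : cell i k p -> tower_cells (le^~ k) (fun j => m j k) p.
  move=> Cp; exists i, k, p; split=> //; first exact: tower_le_refl.
  by rewrite m_id.
split.
- move=> j /lek[ji|->]; last by rewrite m_id.
  by rewrite (m_comp ji ik); apply: inj_comp => //; exact: inj.
- apply: subset_trans ag _; apply: gen_sub => p [[q /g /(gen_image (m i k)) + <-]|Cp].
    by apply: gen_sub => _ [q' Cq <-]; apply: gen_base; exact: cellm.
  by apply: gen_base; exact: cellk.
- move=> y ny; have [[x _ xy]|[p [t [Cp t01 pty]]]] := apt y; last first.
    by exists p, t; split=> //; exact: cellk.
  have [|p [t [Cp t01 ptx]]] := pt x; first by move=> /ms; rewrite xy.
  by exists (m i k \o p), t; split=> //=; [exact: cellm|rewrite ptx].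
- move=> j /lek[ji|-> y sy]; last by exists y => //; rewrite m_id.
  move=> y /ast[x /(sts _ ji)[z sz <-] <-]; exists z => //.
  by rewrite (m_comp ji ik).
Qed.

Lemma stage_tower k : stage (le^~ k) (fun j => m j k).
Proof.
have [_ tr _ wf] := wo; elim/(well_founded_ind wf): k => k IH.
have [[j jk]|nj] := pselect (exists j, lt j k); last first.
  have [_ dst dex] := m_min (fun j jk => nj (ex_intro _ j jk)).
  have lek j : le j k -> j = k by move=> [jk|//]; case: nj; exists j.
  split.
  - by move=> j /lek ->; rewrite m_id.
  - by rewrite dex.
  - by move=> x; rewrite dst => -[].
  - by move=> j /lek -> y sy; exists y => //; rewrite m_id.
have [[i ik]|ni] := pselect (exists i, is_succ lt i k).
  by apply: (stage_succ ik); apply: IH; case: ik.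
have lim : is_limit_index lt k.
  by split; [exists j|move=> i ik; apply: ni; exists i].
have [||inj g pt sts] := stage_colimit (m_lim lim).
- by move=> i i' i'k [ii'|->//]; exact: tr i'k.
- exact: IH.
(* The colimit covers only the indices below [k]; adding [k] itself is harmless because [m k k] is
   the identity. *)
have sub : tower_cells (fun j => lt j k) (fun j => m j k) `<=`
    tower_cells (le^~ k) (fun j => m j k).
  by move=> _ [i [i' [p [i'k s Cp ->]]]]; exists i, i', p; split=> //; left.
split.
- by move=> i [/inj//|->]; rewrite m_id.
- by apply: subset_trans g _; apply: gen_sub => p /sub; exact: gen_base.
- by move=> x /pt[p [t [/sub ? ? ?]]]; exists p, t.
- by move=> i [/sts//|-> y sy]; exists y => //; rewrite m_id.
Qed.

Lemma tower_cell_paths (X : mdspace) (c : forall i, D i -> X) :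
  is_colimit le setT D m X c -> cell_paths (tower_cells setT c).
Proof.
move=> co; have [inj g pt sts] : stage setT c.
  by apply: (stage_colimit co) => // i _; exact: stage_tower.
have [cm cc _] := co; have [irr tr tot _] := wo.
(* An arc attached at [j] before [j'] lies in the image of the predecessor [D i'], which the open
   arcs attached at [j'] avoid. *)
have lt_contra i j i' j' p p' t t' : is_succ lt i j -> is_succ lt i' j' ->
    cell i j p -> cell i' j' p' -> 0 < t' < 1 -> lt j j' -> c j (p t) = c j' (p' t') -> False.
  move=> s s' Cp Cp' t01 jj; rewrite -(cc j j' I I (or_introl jj)) /= => /(inj j' I) e.
  have [_ _ _ _ [_ out _]] := m_succ s'; apply: (out _ _ Cp' t01); rewrite -e.
  have ji := tower_succ_le s' jj; have ij' : le i' j' by left; case: s'.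
  by rewrite (m_comp ji ij'); exists (m j i' (p t)).
split=> //.
- move=> _ [i [j [p [_ s Cp ->]]]]; have [_ _] := cm j I; apply.
  by have [_ + _ _ _] := m_succ s; apply.
- move=> _ t [i [j [p [_ s Cp ->]]]] t01 /(sts j I)[x sx /(inj j I) xp].
  have [_ _ _ ast [_ out _]] := m_succ s; apply: (out _ _ Cp t01); rewrite -xp.
  by have [z _ <-] := ast _ sx; exists z.
- move=> _ _ t t' [i [j [p [_ s Cp ->]]]] [i' [j' [p' [_ s' Cp' ->]]]] t01 t'01 /= e.
  case: (tot j j') => [jj|jj|jj].
  + by case: (lt_contra _ _ _ _ _ _ _ _ s s' Cp Cp' t'01 jj e).
  (* Predecessors are unique, so both arcs belong to the same attachment. *)
  + subst j'; have ii : i = i'.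
      have [ij _] := s; have [ij' _] := s'.
      by have [ii|//] := tower_succ_le s' ij; case: (s.2 i').
    subst i'; have [_ _ _ _ [_ _ dis]] := m_succ s.
    by have [-> ->] := dis _ _ _ _ Cp Cp' t01 t'01 (inj j I _ _ e).
  + by case: (lt_contra _ _ _ _ _ _ _ _ s' s Cp' Cp t01 jj (esym e)).
Qed.

End Tower.

Lemma cellular_cell_paths (X : mdspace) : cellular X -> exists C, @cell_paths X C.
Proof.
move=> [idx [lt [D [m [c]]]]] /= [wo mm mid mcomp [mmin msucc mlim mX]].
(* Guarding by [is_succ] lets arcs be chosen for all pairs of indices, with the empty set as
   default. *)
have E i j : exists C, is_succ lt i j -> attaches (m i j) C.
  have [s|ns] := pselect (is_succ lt i j); last by exists set0.
  have [n [GS [qS [eS [GD [qD [eD [iota [a [b]]]]]]]]]] := msucc i j s.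
  move=> [gS gD iq ie [am po]].
  by have [C] := pushout_glob_attaches gS gD iq ie am po; exists C.
exists (tower_cells lt (fun i j => projT1 (cid (E i j))) setT c).
apply: (tower_cell_paths wo mm mid mcomp mmin _ mlim mX) => i j.
by case: cid.
Qed.

Theorem theorem9p3 (X Y : mdspace) (f : X -> Y) :
  cellular X -> cellular Y -> mdmap f ->
  (homeomorphism f <-> Sp_iso f).
Proof.
move=> /cellular_cell_paths[CX cX] /cellular_cell_paths[CY cY] fm.
exact: homeomorphism_Sp_iso fm cX cY.
Qed.
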